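(* Let $p$ be an odd prime and let $g\geq 1$ be an integer. Let $C$ be the $(p-1)\times(p-1)$ matrix whose non-zero entries are given by $C_{ii}=2$ for $1\leq i\leq p-1$ and $C_{j,j-1}=C_{j-1,j}=1$ for $2\leq j\leq p-1$. Then for every integer $n$ with $1\leq n\leq p-1$ one has $$(C^g)_{n,1}= \frac{2^{2g+1}}{p} \sum_{j=1}^{(p-1)/2} \left(\sin\frac{2\pi jn}{p}\right) \left(\sin\frac{2\pi j}{p}\right) \left( \left(\cos\frac{\pi j}{p}\right)^{2g} - (-1)^{n} \left(\sin\frac{\pi j}{p}\right)^{2g}\right).$$
   Context: $(C^g)_{n,1}$ denotes the entry in row $n$ and column $1$ of the $g$-th power of the matrix $C$ (rows and columns indexed by $1,\dots,p-1$). All other entries of $C$ are $0$. *)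

(* Defs.v *)
From HB Require Import structures.
From mathcomp Require Import all_boot all_order all_algebra.
From mathcomp Require Import reals trigo.
Set Implicit Arguments.
Unset Strict Implicit.
Unset Printing Implicit Defensive.
Import Order.TTheory GRing.Theory Num.Theory.
Local Open Scope ring_scope.

(* Rows and columns are numbered from 1 in the mathematics and from 0 in
   ['I_m]: [idx hk : 'I_m] is the index numbered [k], of value [k.-1]. *)
Lemma idx_subproof (m k : nat) : (1 <= k <= m)%N -> (k.-1 < m)%N.
Proof. by case: k. Qed.

Definition idx (m k : nat) (hk : (1 <= k <= m)%N) : 'I_m :=
  Ordinal (idx_subproof hk).

Lemma prime_range1 (p : nat) : prime p -> (1 <= 1 <= p.-1)%N.
Proof. by case: p => [|[|p]]. Qed.

(* Differences of indices do not depend on where the numbering starts, so the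
   0-based [i] and [j] can be compared directly. *)
Definition Cmx (R : realType) (m : nat) : 'M[R]_m :=
  \matrix_(i, j)
    if i == j then 2
    else if (i == j.+1 :> nat) || (j == i.+1 :> nat) then 1
    else 0.

(* Main.v *)
(** With [x = pi j / p], the sequence [n |-> sin (2 n x) cos x ^ 2g] satisfies
    [2 u n + u (n-1) + u (n+1) = (2 + 2 cos (2x)) u n = 4 (cos x)^2 u n], and
    [n |-> (-1)^n sin (2 n x) sin x ^ 2g] satisfies the same relation with
    [2 - 2 cos (2x) = 4 (sin x)^2]. Both vanish at [n = 0] and [n = p], so the
    right-hand side obeys the recurrence in [g] expressing multiplication by
    [C]. For [g = 0] it is the indicator of [n = 1], by a Dirichlet kernel
    evaluation. *)
Require Import Defs.
From HB Require Import structures.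
From mathcomp Require Import all_boot all_order all_algebra.
From mathcomp Require Import ring lra zify.
From mathcomp Require Import reals trigo.
Import Order.TTheory GRing.Theory Num.Theory.
Local Open Scope ring_scope.

Lemma sum_ord_delta (R : pzRingType) (m a : nat) (f : nat -> R) :
  \sum_(k < m) (k == a :> nat)%:R * f k = if (a < m)%N then f a else 0.
Proof.
case: ltnP => [lt_am|le_ma].
  rewrite (bigD1 (Ordinal lt_am)) //= eqxx mul1r big1 ?addr0 // => k.
  by rewrite -val_eqE /= => /negPf ->; rewrite mul0r.
rewrite big1 // => k _.
by rewrite ltn_eqF ?mul0r // (leq_trans (ltn_ord k)).
Qed.

(** The zeros of [f] at [0] and [m.+1] stand in for the missing neighbours in the first and last
    rows, so one three-term formula serves every row. *)
Lemma sum_CmxE (R : realType) (m : nat) (f : nat -> R) (i : 'I_m) :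
  f 0%N = 0 -> f m.+1 = 0 ->
  \sum_k Cmx R m i k * f k.+1 = 2 * f i.+1 + f i + f i.+2.
Proof.
move=> f0 fm.
pose d a (k : 'I_m) : R := (k == a :> nat)%:R * f k.+1.
have sum_d a : \sum_k d a k = if (a < m)%N then f a.+1 else 0.
  exact: (@sum_ord_delta _ m a (fun k => f k.+1)).
have -> : f i = \sum_(k < m) (i == k.+1 :> nat)%:R * f k.+1.
  case: i => [[|i] lt_im] /=; first by rewrite big1 // => k _; rewrite mul0r.
  have := sum_d i; rewrite ltnW // => <-.
  by apply: eq_bigr => k _; rewrite eqSS eq_sym.
have -> : f i.+2 = \sum_k d i.+1 k.
  rewrite sum_d; case: ltnP => // le_mi.
  by have <- : m = i.+1 by apply/eqP; rewrite eqn_leq le_mi ltn_ord.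
have -> : f i.+1 = \sum_k d i k by rewrite sum_d ltn_ord.
rewrite mulr_sumr -!big_split /=; apply: eq_bigr => k _.
rewrite mxE /d -val_eqE /=.
case: (ltngtP i k) => [lt_ik|lt_ki|->].
- by rewrite (ltn_eqF (ltnW lt_ik : (i < k.+1)%N)); case: eqP => _ /=; ring.
- by rewrite (ltn_eqF (ltnW lt_ki : (k < i.+1)%N)) orbF; case: eqP => _ /=; ring.
by rewrite (ltn_eqF (ltnSn k)) /=; ring.
Qed.

Section Trigonometry.
Variable R : realType.
Implicit Types x : R.

Lemma sin_natmul_pi (m : nat) : sin (m%:R * pi) = 0 :> R.
Proof.
elim: m => [|m IH]; first by rewrite mul0r sin0.
by rewrite -natr1 mulrDl mul1r sinDpi IH oppr0.
Qed.

(** Telescoping: [2 * sin x * cos (2jx)] is [sin ((2j+1)x) - sin ((2j-1)x)]. *)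
Lemma dirichlet_kernel x (h : nat) :
  2 * sin x * \sum_(1 <= j < h.+1) cos (2 * j%:R * x) =
  sin ((2 * h + 1)%:R * x) - sin x.
Proof.
elim: h => [|h IH]; first by rewrite big_geq // mulr0 mul1r subrr.
rewrite big_nat_recr //= mulrDr IH.
have -> : (2 * h.+1 + 1)%:R * x = 2 * h.+1%:R * x + x.
  by rewrite natrD natrM; ring.
have -> : (2 * h + 1)%:R * x = 2 * h.+1%:R * x - x.
  by rewrite natrD natrM -natr1; ring.
rewrite sinB sinD; ring.
Qed.

(** At [x = m pi / p] the top term of the kernel is [sin (m pi) = 0], and [sin x] can be cancelled
    because [0 < x < pi]. *)
Lemma sum_cos_half_period (p m : nat) : odd p -> (0 < m < p)%N ->
  \sum_(1 <= j < (p.-1 %/ 2).+1) cos (2 * j%:R * (m%:R * pi / p%:R)) =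
  - 2^-1 :> R.
Proof.
move=> p_odd /andP[m0 mp]; set h := (p.-1 %/ 2)%N; set x := m%:R * pi / p%:R.
have p0 : 0 < p%:R :> R by rewrite ltr0n (ltn_trans m0 mp).
have sinx : sin x != 0.
  rewrite gt_eqF // sin_gt0_pi // divr_gt0 ?mulr_gt0 ?pi_gt0 ?p0 ?ltr0n //=.
  by rewrite ltr_pdivrMr // mulrC ltr_pM2l ?pi_gt0 // ltr_nat.
have := dirichlet_kernel x h.
have -> : (2 * h + 1)%N = p by rewrite /h; lia.
have -> : p%:R * x = m%:R * pi by rewrite mulrC divfK ?gt_eqF.
rewrite sin_natmul_pi sub0r => E.
apply: (mulfI (mulf_neq0 _ sinx : 2 * sin x != 0)); first by rewrite pnatr_eq0.
by rewrite E; lra.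
Qed.

Definition wave (x : R) (g n : nat) : R :=
  sin (2 * n%:R * x) * sin (2 * x) *
  (cos x ^+ (2 * g) - (-1) ^+ n * sin x ^+ (2 * g)).

Lemma waveS x g n :
  4 * wave x g.+1 n.+1 = 2 * wave x g n.+1 + wave x g n + wave x g n.+2.
Proof.
rewrite /wave.
have -> : 2 * n%:R * x = 2 * n.+1%:R * x - 2 * x by rewrite -natr1; ring.
have -> : 2 * n.+2%:R * x = 2 * n.+1%:R * x + 2 * x by rewrite -[n.+2%:R]natr1; ring.
set y := 2 * n.+1%:R * x.
(* The [cos y] terms of the two neighbours cancel; their sign [(-1) ^ n] is opposite to that of the
   middle term, which turns [2 + 2 cos (2x)] into [2 - 2 cos (2x)] in the sine part. *)
rewrite sinB sinD.
have -> : cos (2 * x) = cos x ^+ 2 - sin x ^+ 2.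
  by rewrite mulr_natl cos_mulr2n; have := cos2Dsin2 x; lra.
rewrite !mulnS !exprD ![(-1) ^+ _.+1]exprS.
set z := sin (2 * x); set u := cos x ^+ (2 * g); set v := sin x ^+ (2 * g).
have -> : cos x ^+ 2 = 1 - sin x ^+ 2 by have := cos2Dsin2 x; lra.
ring.
Qed.

End Trigonometry.

Arguments wave {R}.

(** Taking [n] in [nat] rather than in ['I_p.-1] gives access to the boundary values at [0] and
    [p]. *)
Definition wave_sum (R : realType) (p g n : nat) : R :=
  2 ^+ (2 * g + 1)%N / p%:R *
  \sum_(1 <= j < (p.-1 %/ 2).+1) wave (pi * j%:R / p%:R) g n.

Lemma wave_sum_at0 (R : realType) p g : wave_sum R p g 0 = 0.
Proof.
rewrite /wave_sum big1 ?mulr0 // => j _.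
by rewrite /wave mulr0 mul0r sin0 !mul0r.
Qed.

Lemma wave_sum_atp (R : realType) p g : (0 < p)%N -> wave_sum R p g p = 0.
Proof.
move=> p0; rewrite /wave_sum big1 ?mulr0 // => j _; rewrite /wave.
have -> : 2 * p%:R * (pi * j%:R / p%:R) = (2 * j)%:R * pi :> R.
  by rewrite natrM; field; rewrite pnatr_eq0 -lt0n.
by rewrite sin_natmul_pi !mul0r.
Qed.

Lemma wave_sumS (R : realType) p g n :
  wave_sum R p g.+1 n.+1 =
  2 * wave_sum R p g n.+1 + wave_sum R p g n + wave_sum R p g n.+2.
Proof.
rewrite /wave_sum.
have -> : 2 ^+ (2 * g.+1 + 1)%N = 2 ^+ (2 * g + 1)%N * 4 :> R.
  by rewrite mulnS -addnA addnC exprD; ring.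
set K := 2 ^+ _.
rewrite [LHS](_ : _ = K / p%:R *
  (4 * \sum_(1 <= j < (p.-1 %/ 2).+1) wave (pi * j%:R / p%:R) g.+1 n.+1)); last by ring.
rewrite mulr_sumr (eq_bigr _ (fun j _ => waveS _ _ _ _)) !big_split /= -mulr_sumr.
ring.
Qed.

Lemma wave_sum_g0 (R : realType) p n : odd p -> (n < p.-1)%N ->
  wave_sum R p 0 n.+1 = (n == 0%N)%:R.
Proof.
move=> p_odd lt_np; rewrite /wave_sum /wave.
have pN0 : p%:R != 0 :> R by rewrite pnatr_eq0; lia.
(* At [g = 0] the last factor is [1 - (-1) ^ n.+1]: it is [0] for odd [n] and [2] for even [n], and
   this [2] is what the product-to-sum formula for the sines needs. *)
have [odd_n|even_n] := boolP (odd n).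
  rewrite big1 => [|j _]; first by rewrite mulr0; case: n odd_n {lt_np}.
  by rewrite !expr0 -signr_odd /= odd_n /= expr0 mulr1 subrr mulr0.
pose S m : R := \sum_(1 <= j < (p.-1 %/ 2).+1)
  cos (2 * j%:R * (m%:R * pi / p%:R)).
have -> : \sum_(1 <= j < (p.-1 %/ 2).+1)
    sin (2 * n.+1%:R * (pi * j%:R / p%:R)) * sin (2 * (pi * j%:R / p%:R)) *
    (cos (pi * j%:R / p%:R) ^+ (2 * 0)
     - (-1) ^+ n.+1 * sin (pi * j%:R / p%:R) ^+ (2 * 0)) = S n - S n.+2.
  rewrite /S -sumrB; apply: eq_bigr => j _.
  rewrite !expr0 -signr_odd /= (negPf even_n) /= expr1 mulr1 opprK.
  set x := pi * j%:R / p%:R.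
  have -> : 2 * j%:R * (n%:R * pi / p%:R) = 2 * n.+1%:R * x - 2 * x.
    by rewrite /x -natr1; ring.
  have -> : 2 * j%:R * (n.+2%:R * pi / p%:R) = 2 * n.+1%:R * x + 2 * x.
    by rewrite /x -[n.+2%:R]natr1; ring.
  rewrite cosB cosD; ring.
(* Parity excludes [n.+2 = p], as [n] is even and [p] odd. *)
have lt_n2p : (n.+2 < p)%N by lia.
rewrite {2}/S sum_cos_half_period //.
case: n even_n lt_np lt_n2p => [|n] _ lt_np lt_n2p; last first.
  rewrite /S sum_cos_half_period ?subrr ?mulr0 //; lia.
(* For [n = 0] the sum [S 0] consists of [h] ones, so the difference is [h + 1/2 = p/2], which the
   prefactor [2/p] normalises to [1]. *)
rewrite /S (eq_bigr (fun=> 1)) => [|j _]; last by rewrite !mul0r mulr0 cos0.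
rewrite sumr_const_nat subn1 /= expr1.
set h := (p.-1 %/ 2)%N.
have pE : p%:R = h%:R * 2 + 1 :> R.
  by rewrite -natrM natr1; congr _%:R; rewrite /h; lia.
by rewrite pE in pN0 *; field.
Qed.

(** Induction on [g] through [C ^ g.+1 = C * C ^ g], for all rows of the first column at once. *)
Lemma Cmx_exp_wave_sum (R : realType) p g (i k : 'I_p.-1) : odd p ->
  k = 0%N :> nat -> (Cmx R p.-1 ^+ g) i k = wave_sum R p g i.+1.
Proof.
move=> p_odd k0; elim: g i => [|g IH] i.
  by rewrite expr0 mxE wave_sum_g0 // -val_eqE /= k0.
rewrite exprS mxE wave_sumS -(@sum_CmxE _ _ (wave_sum R p g)) ?wave_sum_at0 //.
  by apply: eq_bigr => l _; rewrite IH.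
by rewrite prednK ?wave_sum_atp // odd_gt0.
Qed.

Theorem theorem2 (R : realType) (p : nat) (p_prime : prime p) (p_odd : odd p)
    (g : nat) (g_ge1 : (1 <= g)%N) (n : nat) (n_range : (1 <= n <= p.-1)%N) :
  (Cmx R p.-1 ^+ g) (idx n_range) (idx (prime_range1 p_prime)) =
  2 ^+ (2 * g + 1)%N / p%:R *
  \sum_(1 <= j < (p.-1 %/ 2).+1)
    sin (2 * pi * j%:R * n%:R / p%:R) * sin (2 * pi * j%:R / p%:R) *
    (cos (pi * j%:R / p%:R) ^+ (2 * g)
     - (-1) ^+ n * sin (pi * j%:R / p%:R) ^+ (2 * g)).
Proof.
rewrite Cmx_exp_wave_sum //= prednK; last by case/andP: n_range.
congr (_ * _); apply: eq_bigr => j _; rewrite /wave.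
by congr (sin _ * sin _ * _); ring.
Qed.
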